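(* Let $N,r\ge 1$ be integers such that neither $Nr$ nor $Nr+1$ is a perfect square. Let $f$ be a divisor of $Nr+1$ with $1\le f<\sqrt{Nr+1}$. Then $[\mathcal{X}(N,r,f)]>0$ if and only if $l(Nr)<f\le l(Nr+1)$.
   Context: For an integer $n\ge 1$, $l(n)$ denotes the largest positive divisor $d$ of $n$ with $d\le\sqrt{n}$. For integers $N,r\ge 1$ and a positive divisor $f$ of $Nr+1$, define $$\mathcal{X}(N,r,f)=\Big\{(a+b)-\Big(f+\tfrac{Nr+1}{f}\Big): a,b \text{ positive integers with } ab=Nr\Big\},$$ a finite set of integers. The notation $[\mathcal{X}(N,r,f)]>0$ means that every element of $\mathcal{X}(N,r,f)$ is a positive integer. *)

(* Defs.v *)
From HB Require Import structures.
From mathcomp Require Import all_boot all_order all_algebra.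
From mathcomp Require Import realalg classical_sets.
Set Implicit Arguments.
Unset Strict Implicit.
Unset Printing Implicit Defensive.
Import Order.TTheory GRing.Theory Num.Theory.
Local Open Scope ring_scope.

(* Square roots of natural numbers are taken in the real closed field of real
   algebraic numbers. *)
Definition sqrtn (n : nat) : realalg := Num.sqrt n%:R.

(* For 0 < n the range contains d = 1, so the maximum is attained; the junk
   value at n = 0 is 0. *)
Definition l (n : nat) : nat :=
  (\max_(d <- divisors n | (d%:R <= sqrtn n)%R) d)%N.

Definition perfect_square (n : nat) : Prop := exists m : nat, n = (m ^ 2)%N.

(* The division by f is exact when f divides N * r + 1, the only case meant. *)
Definition X (N r f : nat) : set int :=
  [set x : int | exists a b : nat,
     [/\ (0 < a)%N, (0 < b)%N, (a * b)%N = (N * r)%N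
       & x = (a%:Z + b%:Z) - (f%:Z + ((N * r + 1) %/ f)%N%:Z)]]%classic.

Definition all_positive (A : set int) : Prop := forall x : int, A x -> 0 < x.

(* Main.v *)
Require Import Defs.
From mathcomp Require Import all_boot all_order all_algebra.
From mathcomp Require Import realalg classical_sets.
From mathcomp Require Import zify.
Import Order.TTheory GRing.Theory Num.Theory.
Local Open Scope ring_scope.

(** Put M = N r, let g = (M + 1) / f, so that f < g, and let a b = M with
    a <= b.  Then (f - a)(g - a) = a (a + b - f - g) + 1.  If a < f, the left
    side is at least 2, so a + b > f + g; if f <= a, then a^2 <= M < f g gives
    a < g, the left side is at most 0 and a + b < f + g.  So positivity means
    that every divisor a of M with a^2 <= M is less than f, that is l(M) < f.
    The bound f <= l(M + 1) holds by maximality. *)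

Lemma ler_sqrtn (d n : nat) : (d%:R <= sqrtn n) = (d ^ 2 <= n)%N.
Proof.
by rewrite /sqrtn -(ler_sqr (x := d%:R)) ?nnegrE ?sqrtr_ge0 ?ler0n //
  sqr_sqrtr ?ler0n // -natrX ler_nat.
Qed.

Lemma ltr_sqrtn (d n : nat) : (d%:R < sqrtn n) = (d ^ 2 < n)%N.
Proof.
by rewrite /sqrtn -(ltr_sqr (x := d%:R)) ?nnegrE ?sqrtr_ge0 ?ler0n //
  sqr_sqrtr ?ler0n // -natrX ltr_nat.
Qed.

Lemma leq_l (d n : nat) : (0 < n)%N -> (d %| n)%N -> (d ^ 2 <= n)%N ->
  (d <= l n)%N.
Proof.
move=> n0 dn d2; rewrite /l.
by apply: (leq_bigmax_seq (F := id)); rewrite -?dvdn_divisors ?ler_sqrtn.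
Qed.

Lemma l_dvdn_sqr (n : nat) : (0 < n)%N -> (l n %| n)%N && (l n ^ 2 <= n)%N.
Proof.
move=> n0; have l0 : (0 < l n)%N by apply: leq_l.
(* The alternative 0, the value of an empty maximum, lets the claim start the induction; it then
   passes to the larger of two values. *)
suff: (l n == 0)%N || (l n %| n)%N && (l n ^ 2 <= n)%N.
  by rewrite (gtn_eqF l0).
rewrite /l big_seq_cond.
elim/big_ind: _ => // [x y Px Py|d /andP[]]; first by case: (leqP x y).
by rewrite -dvdn_divisors // ler_sqrtn => -> ->; rewrite orbT.
Qed.

Lemma sum_gt_divisor (f g a b : nat) : (0 < a <= b)%N -> (f < g)%N ->
  (f * g = a * b + 1)%N -> (f + g < a + b)%N = (a < f)%N.
Proof.
move=> /andP[a0 ab] fg E.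
by apply/idP/idP; nia.
Qed.

Theorem theorem2p3 (N r f : nat) (hN : (1 <= N)%N) (hr : (1 <= r)%N)
    (hsq : ~ perfect_square (N * r)) (hsq1 : ~ perfect_square (N * r + 1))
    (hdvd : (f %| N * r + 1)%N) (hf1 : (1 <= f)%N)
    (hf : (f%:R : realalg) < sqrtn (N * r + 1)) :
  all_positive (X N r f) <-> (l (N * r) < f <= l (N * r + 1))%N.
Proof.
have M0 : (0 < N * r)%N by rewrite muln_gt0 hN.
rewrite /X; move: (N * r)%N M0 hdvd hf {hsq hsq1} => M M0 hdvd.
rewrite ltr_sqrtn => hf.
have -> : (f <= l (M + 1))%N by apply: leq_l; rewrite ?(ltnW hf) // addn1.
rewrite andbT.
have : (f * ((M + 1) %/ f) = M + 1)%N by rewrite mulnC divnK.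
move: ((M + 1) %/ f)%N => g fgE.
have fg : (f < g)%N by rewrite -(ltn_pmul2l hf1) fgE mulnn.
split=> [pos|lf x [a [b [a0 b0 abM ->]]]].
  (* Positivity is tested on the single factorization [M = b * l M], whose factors are the closest
     together and so have the smallest sum. *)
  have /andP[/dvdnP[b bE] l2] := l_dvdn_sqr M M0.
  have l0 : (0 < l M)%N by apply: leq_l.
  have lb : (l M <= b)%N by rewrite -(leq_pmul2r l0) mulnn -bE.
  rewrite -(@sum_gt_divisor f g (l M) b) ?l0 //; last by rewrite (mulnC (l M)) -bE.
  suff: 0 < ((l M)%:Z + b%:Z) - (f%:Z + g%:Z) :> int by lia.
  by apply: pos; exists (l M), b; split; rewrite ?(leq_trans l0) // (mulnC (l M)) -bE.
suff: (f + g < a + b)%N by lia.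
(* By symmetry [a] is the smaller factor; then [a ^ 2 <= M], so [a] competes in the maximum and
   [a <= l M < f]. *)
wlog ab : a b a0 b0 abM / (a <= b)%N => [H|].
  have [/H|/ltnW/H] := leqP a b; first exact.
  by rewrite [(b + a)%N]addnC; apply=> //; rewrite mulnC.
rewrite sum_gt_divisor ?a0 ?abM //; apply: leq_ltn_trans lf.
apply: leq_l => //; first by rewrite -abM dvdn_mulr.
by rewrite -abM -mulnn leq_mul2l ab orbT.
Qed.
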